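(* Let $N\ge 1$, $\eta>0$, and let $J:\mathbb{R}^N\to[0,\infty)$ be measurable, radially symmetric, with $\int_{\mathbb{R}^N}J(y)\,dy=1$, $H(p)=\int_{\mathbb{R}^N}(e^{p\cdot y}-1)J(y)\,dy<+\infty$ for every $p\in\mathbb{R}^N$, and $\operatorname{supp}(J)=\overline{B}_\eta$. Then $$L^*(|q|)\sim\frac{|q|\ln|q|}{\eta}\qquad\text{as }|q|\to+\infty,$$ i.e. the ratio of the two sides tends to $1$.
   Context: $\overline{B}_\eta$ is the closed ball of radius $\eta$ centred at $0$ in $\mathbb{R}^N$. $L(q)=\sup_{p\in\mathbb{R}^N}\{p\cdot q-H(p)\}$ for $q\in\mathbb{R}^N$ is the Legendre–Fenchel transform of $H$. It is radially symmetric, and $L^*:[0,\infty)\to\mathbb{R}$ is its radial profile: $L^*(|q|)=L(q)$. *)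

(* Defs.v *)
(* MathComp-Analysis, over an abstract realType R; points of R^N are row
   vectors 'rV[R]_N.  MathComp-Analysis has Lebesgue measure only on R and its
   norm on 'rV is the sup norm, hence the first definitions below. *)
From HB Require Import structures.
From mathcomp Require Import all_boot all_order all_algebra.
From mathcomp Require Import all_classical all_reals all_analysis.

Set Implicit Arguments.
Unset Strict Implicit.
Unset Printing Implicit Defensive.

Import Order.TTheory GRing.Theory Num.Theory.
Import numFieldNormedType.Exports.

Local Open Scope classical_set_scope.
Local Open Scope ring_scope.

Definition rV_display : measure_display -> measure_display.
Proof. exact. Qed.

(* The product sigma-algebra on R^n, generated by the coordinates; it is the
   Borel sigma-algebra of R^n. *)
Section measurable_rV.
Context (R : realType) (n : nat).

Let coors : 'I_n -> 'rV[R]_n -> R := fun i x => x ord0 i.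

Let rV_set0 : g_sigma_preimage coors set0.
Proof. exact: sigma_algebra0. Qed.

Let rV_setC A : g_sigma_preimage coors A -> g_sigma_preimage coors (~` A).
Proof. exact: sigma_algebraC. Qed.

Let rV_bigcup (F : _^nat) : (forall i, g_sigma_preimage coors (F i)) ->
  g_sigma_preimage coors (\bigcup_i (F i)).
Proof. exact: sigma_algebra_bigcup. Qed.

HB.instance Definition _ := @isMeasurable.Build
  (rV_display (R.-ocitv.-measurable).-sigma)
  'rV[R]_n (g_sigma_preimage coors) rV_set0 rV_setC rV_bigcup.

Lemma measurable_coor (i : 'I_n) :
  measurable_fun [set: 'rV[R]_n] (fun x : 'rV[R]_n => x ord0 i).
Proof.
move=> _ Y mY; rewrite setTI; apply: sub_sigma_algebra => /=.
rewrite -bigcup_seq/=; exists i => /=; first by rewrite mem_index_enum.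
by exists Y => //; rewrite setTI.
Qed.

Lemma measurable_fun_coorP d (T : measurableType d) (f : T -> 'rV[R]_n) :
  measurable_fun [set: T] f <->
  forall i, measurable_fun [set: T] (fun x => f x ord0 i).
Proof.
split=> [mf i|mf].
  by apply: (measurableT_comp (measurable_coor i)).
have : g_sigma_preimage (fun i => coors i \o f) `<=` measurable.
  apply: smallest_sub; first exact: sigma_algebra_measurable.
  move=> A; rewrite -bigcup_seq/= => -[i _] [B mB <-].
  exact: mf.
rewrite g_sigma_preimage_comp => prefS _ A mA.
by apply: prefS; exists A.
Qed.

End measurable_rV.

Section lebesgue_rV.
Context (R : realType).

Definition cons_rV n (z : R * 'rV[R]_n) : 'rV[R]_n.+1 := row_mx z.1%:M z.2.

Definition uncons_rV n (v : 'rV[R]_n.+1) : R * 'rV[R]_n :=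
  (v ord0 ord0, \row_i v ord0 (lift ord0 i)).

Lemma cons_rV0 n (z : R * 'rV[R]_n) : cons_rV z ord0 ord0 = z.1.
Proof.
transitivity (row_mx z.1%:M z.2 ord0 (lshift n ord0)); last first.
  by rewrite row_mxEl mxE.
by congr (row_mx _ _ _ _); exact: val_inj.
Qed.

Lemma cons_rVS n (z : R * 'rV[R]_n) i :
  cons_rV z ord0 (lift ord0 i) = z.2 ord0 i.
Proof.
transitivity (row_mx z.1%:M z.2 ord0 (rshift 1 i)); last by rewrite row_mxEr.
by congr (row_mx _ _ _ _); exact: val_inj.
Qed.

Lemma cons_rVK n : cancel (@cons_rV n) (@uncons_rV n).
Proof.
move=> [x v]; rewrite /uncons_rV cons_rV0; congr pair.
by apply/rowP => i; rewrite mxE cons_rVS.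
Qed.

Lemma measurable_cons_rV n : measurable_fun [set: R * 'rV[R]_n] (@cons_rV n).
Proof.
apply/measurable_fun_coorP => i; case: (unliftP ord0 i) => [j ->|->].
  under eq_fun do rewrite cons_rVS.
  exact: (measurableT_comp (measurable_coor j) measurable_snd).
under eq_fun do rewrite cons_rV0.
exact: measurable_fst.
Qed.

Lemma measurable_uncons_rV n :
  measurable_fun [set: 'rV[R]_n.+1] (@uncons_rV n).
Proof.
apply: measurable_fun_pair; first exact: measurable_coor.
apply/measurable_fun_coorP => i; under eq_fun do rewrite mxE.
exact: measurable_coor.
Qed.

Section succ.
Context (n : nat) (m : {sigma_finite_measure set 'rV[R]_n -> \bar R}).

Definition lebesgue_rVS : set 'rV[R]_n.+1 -> \bar R :=
  pushforward (@lebesgue_measure R \x m)%E (@cons_rV n).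

Let lebesgue_rVS0 : lebesgue_rVS set0 = 0%E.
Proof. by rewrite /lebesgue_rVS /pushforward preimage_set0 measure0. Qed.

Let lebesgue_rVS_ge0 A : (0 <= lebesgue_rVS A)%E.
Proof. by rewrite /lebesgue_rVS /pushforward; exact: measure_ge0. Qed.

Let lebesgue_rVS_sigma_additive : semi_sigma_additive lebesgue_rVS.
Proof.
have mpre A : measurable A -> measurable (@cons_rV n @^-1` A).
  by move=> mA; rewrite -[X in measurable X]setTI; exact: measurable_cons_rV.
move=> F mF tF mUF; rewrite /lebesgue_rVS /pushforward preimage_bigcup.
apply: measure_semi_sigma_additive.
- by move=> k; exact: mpre.
- apply/trivIsetP => /= i j _ _ ij; rewrite -preimage_setI.
  by move/trivIsetP : tF => /(_ _ _ _ _ ij) ->//; rewrite preimage_set0.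
- by rewrite -preimage_bigcup; exact: mpre.
Qed.

HB.instance Definition _ := isMeasure.Build _ _ _ lebesgue_rVS
  lebesgue_rVS0 lebesgue_rVS_ge0 lebesgue_rVS_sigma_additive.

Let lebesgue_rVS_sigma_finite : sigma_finite setT lebesgue_rVS.
Proof.
have /sigma_finiteP[F [TF ndF Foo]] := sigma_finiteT (@lebesgue_measure R).
have /sigma_finiteP[G [TG ndG Goo]] := sigma_finiteT m.
exists (fun k => @uncons_rV n @^-1` (F k `*` G k)) => [|k].
  apply/esym; rewrite -subTset => v _.
  have [i _ Fi] : (\bigcup_i F i) (uncons_rV v).1 by rewrite -TF.
  have [j _ Gj] : (\bigcup_j G j) (uncons_rV v).2 by rewrite -TG.
  exists (maxn i j) => //; split.
  - by move: Fi; exact/subsetPset/ndF/leq_maxl.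
  - by move: Gj; exact/subsetPset/ndG/leq_maxr.
have [mFk Fkoo] := Foo k; have [mGk Gkoo] := Goo k.
have mFG : measurable (F k `*` G k) by exact: measurableX.
split.
  by rewrite -[X in measurable X]setTI; exact: measurable_uncons_rV.
rewrite /lebesgue_rVS /pushforward (_ : _ @^-1` _ = F k `*` G k).
  by rewrite product_measure1E// lte_mul_pinfty// ge0_fin_numE.
by rewrite -comp_preimage (_ : _ \o _ = id)//; apply/funext => z; exact: cons_rVK.
Qed.

HB.instance Definition _ := @Measure_isSigmaFinite.Build _ _ _ lebesgue_rVS
  lebesgue_rVS_sigma_finite.

End succ.

Fixpoint borel_lebesgue n : {sigma_finite_measure set 'rV[R]_n -> \bar R} :=
  if n is n'.+1 then lebesgue_rVS (borel_lebesgue n') else \d_(0 : 'rV[R]_0).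

End lebesgue_rV.

(* Sanity check: the measure of a box is the product of its side lengths. *)
Lemma borel_lebesgue_box (R : realType) n (a b : 'rV[R]_n) :
  (forall i, a ord0 i <= b ord0 i) ->
  borel_lebesgue R n [set x | forall i, a ord0 i <= x ord0 i <= b ord0 i] =
  (\prod_i (b ord0 i - a ord0 i))%:E.
Proof.
elim: n a b => [|n ih] a b ab.
  by rewrite big_ord0 /= /dirac indicE mem_set//= => -[].
rewrite /= /lebesgue_rVS /pushforward big_ord_recl.
pose a' := (uncons_rV a).2; pose b' := (uncons_rV b).2.
transitivity ((@lebesgue_measure R \x borel_lebesgue R n)%E
    (`[a ord0 ord0, b ord0 ord0] `*`
     [set x : 'rV[R]_n | forall i, a' ord0 i <= x ord0 i <= b' ord0 i])).
  congr product_measure1.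
  apply/seteqP; split=> [z /= h|z /= [h1 h2] i].
    split=> /=; first by rewrite in_itv/=; have := h ord0; rewrite cons_rV0.
    by move=> i; have := h (lift ord0 i); rewrite cons_rVS !mxE.
  case: (unliftP ord0 i) => [j ->|->].
    by have := h2 j; rewrite cons_rVS !mxE.
  by move: h1; rewrite /= in_itv /= cons_rV0.
rewrite product_measure1E//=; last first.
  rewrite (_ : mkset _ = \bigcap_(i in [set: 'I_n])
      ((fun x : 'rV[R]_n => x ord0 i) @^-1` `[a' ord0 i, b' ord0 i])).
    apply: fin_bigcap_measurable => // i _.
    by rewrite -[X in measurable X]setTI; exact: measurable_coor.
  by apply/seteqP; split=> [x h i _|x h i] /=; [rewrite in_itv/=|];
    have := h i; rewrite /= ?in_itv //; exact.
rewrite ih; last by move=> i; rewrite !mxE.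
rewrite lebesgue_measure_itv/= lte_fin EFinM; congr (_ * _)%E.
  have := ab ord0; rewrite le_eqVlt => /predU1P[->|->]; last by rewrite EFinB.
  by rewrite ltxx subrr.
by congr EFin; apply: eq_bigr => i _; rewrite !mxE.
Qed.

(* R^n with the sigma-algebra of Lebesgue measurable sets, which is the
   completion of the Borel sigma-algebra. *)
Notation lebesgueRn R n := (caratheodory_type (borel_lebesgue R n)^*%mu).

Definition lebesgue (R : realType) n :
    {measure set (lebesgueRn R n) -> \bar R} :=
  @completed_measure_extension _ _ _ (borel_lebesgue R n).

Section rV_analysis.
Context (R : realType) (n : nat).
Implicit Types (p q x : 'rV[R]_n).

Definition dot p q : R := \sum_i p ord0 i * q ord0 i.

Definition enorm x : R := Num.sqrt (dot x x).

Definition radially_symmetric (f : 'rV[R]_n -> R) :=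
  forall x y, enorm x = enorm y -> f x = f y.

(* Support of a function defined up to null sets: complement of the union of
   the open sets on which the function vanishes almost everywhere. *)
Definition ess_support (f : 'rV[R]_n -> R) : set 'rV[R]_n :=
  ~` \bigcup_(U in [set U : set 'rV[R]_n |
                     open U /\ {ae lebesgue R n, forall x, U x -> f x = 0}]) U.

Definition hamiltonian (J : 'rV[R]_n -> R) p : \bar R :=
  \int[lebesgue R n]_y ((expR (dot p y) - 1) * J y)%:E.

Definition legendre (H : 'rV[R]_n -> \bar R) q : \bar R :=
  ereal_sup [set ((dot p q)%:E - H p)%E | p in [set: 'rV[R]_n]].

End rV_analysis.

(* Main.v *)
Require Import Defs.
From mathcomp Require Import all_boot all_order all_algebra.
From mathcomp Require Import all_classical all_reals all_analysis.
From mathcomp Require Import measurable_realfun ring lra.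

(** Write M(p) for the integral of e^(p.y) J(y), so that H = M - 1.  The growth
of the conjugate L at infinity is governed by the exponential growth rate of M,
which is the radius eta of the support of J.

Upper bound on M.  The density vanishes almost everywhere outside the ball of
radius eta (ae_eq0_notin_ess_support), and there p.y <= eta |p|_1, whence
M(p) <= e^(eta |p|_1) (mgf_le).  Testing the supremum defining L(r e_i) at
p = (ln r / eta) e_i, for which |p|_1 = ln r / eta, gives
L*(r) >= r ln r / eta - r (radial_legendre_ge).

Lower bound on M.  Fix 0 < a < eta.  All p compete in the supremum defining
L(r e_i), but p.q only sees the i-th coordinate of p, so what is needed is a
bound M(p) >= c e^(a p_i) for p_i >= 0, with c > 0 uniform in the other
coordinates (mgf_ge); for p_i < 0 the trivial bound M >= 0 is enough.  The
former comes from restricting the integral to the points y with y_i >= a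
whose other coordinates have the same signs as those of p: there p.y >= a p_i.
There are finitely many sign patterns, and each of the corresponding regions has
positive J-mass because it is a neighbourhood of a point of the support
(integral_gt0_ess_support); c is the least of these masses.
Maximising r t - c e^(a t) over t then yields
L*(r) <= (r / a) (ln r + C) + 1 (radial_legendre_le).

Dividing by r ln r / eta, the lower limit of the ratio is at least 1 and its
upper limit at most eta / a for every a < eta, hence equal to 1
(cvg_div_xlnx). *)

Set Implicit Arguments.
Unset Strict Implicit.
Unset Printing Implicit Defensive.

Import Order.TTheory GRing.Theory Num.Theory.
Import numFieldNormedType.Exports.

Local Open Scope classical_set_scope.
Local Open Scope ring_scope.

(** * The Euclidean norm *)

Section euclidean_norm.
Context (R : realType) (n : nat).
Implicit Types x p : 'rV[R]_n.

Lemma normr_coord_le_enorm x i : `|x ord0 i| <= enorm x.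
Proof.
rewrite /enorm /dot -sqrtr_sqr ler_wsqrtr// (bigD1 i)//= expr2 lerDl.
by apply: sumr_ge0 => j _; rewrite -expr2 sqr_ge0.
Qed.

Lemma enorm_le_sum x : enorm x <= \sum_i `|x ord0 i|.
Proof.
have s0 : 0 <= \sum_i `|x ord0 i| by apply: sumr_ge0.
rewrite -[leRHS]ger0_norm// -sqrtr_sqr ler_wsqrtr// expr2 mulr_suml.
apply: ler_sum => i _.
rewrite (le_trans (ler_norm _))// normrM ler_wpM2l// (bigD1 i)//= lerDl.
exact: sumr_ge0.
Qed.

Lemma enorm_scale_delta (r : R) i :
  0 <= r -> enorm (r *: delta_mx ord0 i : 'rV_n) = r.
Proof.
move=> r0; apply/eqP; rewrite eq_le; apply/andP; split; last first.
  have := normr_coord_le_enorm (r *: delta_mx ord0 i) i.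
  by rewrite !mxE !eqxx mulr1 ger0_norm.
apply: (le_trans (enorm_le_sum _)); rewrite (bigD1 i)//= big1 => [|j ji].
  by rewrite !mxE !eqxx mulr1 addr0 ger0_norm.
by rewrite !mxE (negbTE ji) andbF mulr0 normr0.
Qed.

Lemma dot_scale_delta p (r : R) i : dot p (r *: delta_mx ord0 i) = r * p ord0 i.
Proof.
rewrite /dot (bigD1 i)//= big1 => [|j ji].
  by rewrite !mxE !eqxx mulr1 addr0 mulrC.
by rewrite !mxE (negbTE ji) andbF !mulr0.
Qed.

End euclidean_norm.

(** * Borel sets and functions are Lebesgue measurable *)

Section lebesgue_measurability.
Context (R : realType) (n : nat).

Lemma borel_lebesgue_measurable (A : set 'rV[R]_n) :
  measurable A -> measurable (A : set (lebesgueRn R n)).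
Proof.
move=> mA; apply: (@sub_caratheodory _ _ _ (borel_lebesgue R n)).
exact: sub_sigma_algebra.
Qed.

Lemma measurable_fun_borel_lebesgue (f : 'rV[R]_n -> R) :
  measurable_fun [set: 'rV[R]_n] f ->
  measurable_fun [set: lebesgueRn R n] f.
Proof.
move=> mf _ Y mY; apply: borel_lebesgue_measurable.
exact: mf.
Qed.

Lemma measurable_dot (p : 'rV[R]_n) :
  measurable_fun [set: 'rV[R]_n] (fun y => dot p y).
Proof.
apply: measurable_sum => i.
by apply: measurable_funM => //; exact: measurable_coor.
Qed.

End lebesgue_measurability.

(** * The essential support *)

Section essential_support.
Context (R : realType) (n : nat) (J : 'rV[R]_n -> R).

(** The complement of the essential support is a union of possibly uncountably
many open sets on which [J] vanishes almost everywhere.  Each of its points lies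
in a cube with rational centre and radius [1 / k] contained in one of these open
sets, and there are only countably many such cubes. *)
Lemma ae_eq0_notin_ess_support :
  {ae lebesgue R n, forall x, ~ ess_support J x -> J x = 0}.
Proof.
pose B (a : 'rV[rat]_n) k : set 'rV[R]_n :=
  ball (map_mx ratr a : 'rV[R]_n) (k.+1%:R^-1 : R).
pose null (u : 'rV[rat]_n * nat) :=
  {ae lebesgue R n, forall x, B u.1 u.2 x -> J x = 0}.
pose F (k : nat) : set (lebesgueRn R n) :=
  if @unpickle ('rV[rat]_n * nat)%type k is Some u then
    [set x | null u /\ ~ (B u.1 u.2 x -> J x = 0)] else set0.
have F0 k : (lebesgue R n).-negligible (F k).
  rewrite /F; case: unpickle => [u|]; last exact: negligible_set0.
  have [nu|nu] := pselect (null u).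
    by apply: negligibleS nu => x [].
  by apply: negligibleS (@negligible_set0 _ _ _ _) => x [].
apply: negligibleS (negligible_bigcup F0) => x /=.
move=> /not_implyP[/contrapT[U [oU U0] Ux] Jx].
have /nbhs_ballP[e /= e0 xeU] : nbhs x U by exact: open_nbhs_nbhs.
have [k ke] : exists k : nat, k.+1%:R^-1 < e / 2.
  have /= := near_infty_natSinv_lt (PosNum (divr_gt0 e0 (@ltr0Sn R 1))).
  by case=> k _ /(_ k (leqnn _)) ?; exists k.
have /choice[a xa] : forall i, exists q : rat, `|x ord0 i - ratr q| < k.+1%:R^-1.
  move=> i; have /rat_in_itvoo[q] : x ord0 i - k.+1%:R^-1 < x ord0 i + k.+1%:R^-1.
    by rewrite ltrBlDr -addrA ltrDl addr_gt0.
  by rewrite in_itv/= => qx; exists q; rewrite distrC ltr_distl.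
have axB y : B (\row_i a i) k y <-> forall i, `|ratr (a i) - y ord0 i| < k.+1%:R^-1.
  rewrite /B; split=> [[_ By] i|By].
    by have := By ord0 i; rewrite !mxE.
  by split=> // i j; rewrite ord1 !mxE; exact: By.
have Bx : B (\row_i a i) k x by apply/axB => i; rewrite distrC.
exists (pickle (\row_i a i, k)) => //; rewrite /F pickleK; split => /=; last first.
  by move=> /(_ Bx).
apply: (filterS (F:=almost_everywhere (lebesgue R n))) U0 => y yU /axB By.
apply/yU/xeU; split=> // i j; rewrite ord1.
apply: (le_lt_trans (ler_distD (ratr (a j)) _ _)).
rewrite (splitr e) ltrD//; last exact: lt_trans ke.
exact: lt_trans ke.
Qed.

Hypothesis J0 : forall y, 0 <= J y.
Hypothesis mJ : measurable_fun [set: lebesgueRn R n] J.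

(** Were the integral null, [J] would vanish almost everywhere on the interior
of [V], an open set containing [z]. *)
Lemma integral_gt0_ess_support z (V : set 'rV[R]_n) :
  ess_support J z -> nbhs z V -> measurable V ->
  (0 < \int[lebesgue R n]_(y in V) (J y)%:E)%E.
Proof.
move=> Jz zV mV; have mV' := borel_lebesgue_measurable mV.
have mJV : measurable_fun (V : set (lebesgueRn R n)) (EFin \o J).
  by apply/measurable_EFinP; exact: measurable_funTS.
rewrite lt0e; apply/andP; split; last first.
  by apply: integral_ge0 => y _; rewrite lee_fin.
apply/eqP => JV0; apply: Jz; exists (interior V) => //.
split; first exact: open_interior.
have /(ae_eq_integral_abs _ mV' mJV) :
    (\int[lebesgue R n]_(y in V) `|(EFin \o J) y|)%E = 0.
  rewrite -[RHS]JV0; apply: eq_integral => y _ /=.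
  by rewrite ger0_norm.
apply: (filterS (F:=almost_everywhere (lebesgue R n))) => y Vy /interior_subset /Vy; by case.
Qed.

End essential_support.

(** * Exponential growth of the moment generating function *)

Section moment_generating_function.
Context (R : realType) (n : nat) (J : 'rV[R]_n -> R) (eta : R).
Hypothesis J0 : forall y, 0 <= J y.
Hypothesis mJ : measurable_fun [set: lebesgueRn R n] J.
Hypothesis J1 : (\int[lebesgue R n]_y (J y)%:E = 1)%E.
Hypothesis supp_J : ess_support J = [set x | enorm x <= eta].

Definition mgf (p : 'rV[R]_n) : \bar R :=
  \int[lebesgue R n]_y (expR (dot p y) * J y)%:E.

Let l1 (p : 'rV[R]_n) : R := \sum_j `|p ord0 j|.

Let measurable_mgf_integrand p :
  measurable_fun [set: lebesgueRn R n] (fun y => (expR (dot p y) * J y)%:E).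
Proof.
have mexp : measurable_fun [set: lebesgueRn R n] (fun y => expR (dot p y)).
  apply: measurable_fun_borel_lebesgue.
  by apply: measurableT_comp => //; exact: measurable_dot.
apply/measurable_EFinP; exact: (measurable_funM mexp mJ).
Qed.

(** The l1 norm rather than the Euclidean one: on the ball each coordinate of
[y] is at most [eta] in absolute value, and the two norms agree on the multiples
of a basis vector, where the bound is meant to be sharp. *)
Lemma mgf_le p : (mgf p <= (expR (eta * l1 p))%:E)%E.
Proof.
have mJE : measurable_fun [set: lebesgueRn R n] (EFin \o J) by apply/measurable_EFinP.
have -> : (expR (eta * l1 p))%:E =
    (\int[lebesgue R n]_y ((expR (eta * l1 p))%:E * (J y)%:E))%E.
  rewrite ge0_integralZl//; first by rewrite J1 mule1.
  by move=> y _; rewrite lee_fin.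
apply: ae_ge0_le_integral.
- exact: measurableT.
- by move=> y _; rewrite lee_fin mulr_ge0// expR_ge0.
- exact: measurable_mgf_integrand.
- by move=> y _; rewrite mule_ge0// lee_fin// expR_ge0.
- exact: (emeasurable_funM _ mJE).
apply: (filterS (F:=almost_everywhere (lebesgue R n)))
  (ae_eq0_notin_ess_support J) => y Jy _.
rewrite -EFinM lee_fin; have [ye|/negP ye] := boolP (enorm y <= eta); last first.
  by rewrite Jy ?mulr0// supp_J.
rewrite ler_wpM2r// ler_expR mulr_sumr; apply: ler_sum => i _.
rewrite (le_trans (ler_norm _))// normrM mulrC ler_wpM2r//.
exact: le_trans (normr_coord_le_enorm _ _) ye.
Qed.

(** Splitting the integral is legitimate since both terms are integrable, the
first one thanks to [mgf_le]. *)
Lemma hamiltonian_mgf p : hamiltonian J p = (mgf p - 1)%E.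
Proof.
have mJE : measurable_fun [set: lebesgueRn R n] (EFin \o J) by apply/measurable_EFinP.
rewrite -J1 -integralB//.
- by apply: eq_integral => y _; rewrite mulrBl mul1r EFinB.
- apply/integrableP; split=> //; apply: le_lt_trans (ltry (expR (eta * l1 p))).
  apply: le_trans (mgf_le p); rewrite le_eqVlt; apply/orP; left; apply/eqP.
  by apply: eq_integral => y _; rewrite gee0_abs// lee_fin mulr_ge0// expR_ge0.
- apply/integrableP; split=> //; rewrite (_ : (\int[_]_(x in _) _)%E = 1%E) ?ltry//.
  by rewrite -J1; apply: eq_integral => y _; rewrite gee0_abs// lee_fin.
Qed.

Lemma mgf_ge0 p : (0 <= mgf p)%E.
Proof. by apply: integral_ge0 => y _; rewrite lee_fin mulr_ge0// expR_ge0. Qed.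

Section lower_bound.
Variables (i : 'I_n) (a : R).
Hypotheses (a0 : 0 < a) (aeta : a < eta).

Let orthant (s : {ffun 'I_n -> bool}) : set 'rV[R]_n :=
  [set y | a <= y ord0 i /\ forall j, j != i -> 0 <= (-1) ^+ s j * y ord0 j].

Let measurable_orthant s : measurable (orthant s).
Proof.
pose h j (y : 'rV[R]_n) := if j == i then y ord0 i - a else (-1) ^+ s j * y ord0 j.
have mh j : measurable_fun [set: 'rV[R]_n] (h j).
  rewrite /h; case: (j == i).
    by apply: measurable_funB => //; exact: measurable_coor.
  by apply: measurable_funM => //; exact: measurable_coor.
rewrite (_ : orthant s = \bigcap_(j in [set: 'I_n]) (h j @^-1` `[0, +oo[)).
  apply: fin_bigcap_measurable => // j _.
  by rewrite -[X in measurable X]setTI; exact: mh.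
apply/seteqP; split=> y /=.
  move=> [ay sy] j _; rewrite /= /h in_itv/= andbT.
  by case: eqVneq => [_|/sy//]; rewrite subr_ge0.
move=> hy; split=> [|j ji].
  by have := hy i Logic.I; rewrite /= /h in_itv/= andbT eqxx subr_ge0.
by have := hy j Logic.I; rewrite /= /h in_itv/= andbT (negbTE ji).
Qed.

(** The region has a point of the ball in its interior: take the [i]-th
coordinate halfway between [a] and [eta], and the others equal to [rho] in
absolute value with the prescribed signs.  For [rho] small this point and the
cube of radius [rho] around it have the required properties. *)
Let integral_orthant_gt0 s : (0 < \int[lebesgue R n]_(y in orthant s) (J y)%:E)%E.
Proof.
have n0 : (0 < n%:R :> R) by rewrite ltr0n (leq_trans _ (ltn_ord i)).
(* n * rho is exactly the slack that z_i leaves in the l1 norm below eta *)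
pose rho : R := (eta - a) / (2 * n%:R).
have rho0 : 0 < rho by rewrite divr_gt0 ?subr_gt0// mulr_gt0.
have nrho : n%:R * rho = (eta - a) / 2 by rewrite /rho; field; rewrite gt_eqF.
have rho_le : rho <= (eta - a) / 2.
  by rewrite -nrho ler_peMl ?(ltW rho0)// ler1n (leq_trans _ (ltn_ord i)).
pose z : 'rV[R]_n := \row_j if j == i then (a + eta) / 2 else (-1) ^+ s j * rho.
apply: (@integral_gt0_ess_support _ _ _ J0 mJ z) => //.
- rewrite supp_J /=; apply: le_trans (enorm_le_sum z) _.
  have -> : eta = (a + eta) / 2 + n%:R * rho by rewrite nrho; lra.
  rewrite (bigD1 i)//= lerD//.
    by rewrite mxE eqxx ger0_norm//; have := a0; have := aeta; lra.
  rewrite -[n in n%:R]card_ord -sum1_card natr_sum mulr_suml.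
  rewrite [leRHS](bigD1 i)//= mul1r ler_wpDl ?(ltW rho0)//.
  apply: ler_sum => j ji; rewrite mxE (negbTE ji) normrM normr_sign mul1r.
  by rewrite ger0_norm ?(ltW rho0)// mulr1n mul1r.
- apply/nbhs_ballP; exists rho => // y [_ zy]; split.
    have := zy ord0 i; rewrite /ball/= mxE eqxx ltr_norml => /andP[_ h].
    lra.
  move=> j ji; have := zy ord0 j; rewrite /ball/= mxE (negbTE ji) ltr_norml.
  by case: (s j) => /andP[]; rewrite ?expr1 ?expr0 => *; lra.
Qed.

(** The constant [c] has to be independent of the coordinates of [p] other than
the [i]-th.  If [s] is the sign pattern of [p], then p_j y_j >= 0 for j != i on
the region [orthant s], hence p.y >= a p_i there. *)
Lemma mgf_ge : exists2 c : R, 0 < c &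
  forall p : 'rV[R]_n, 0 <= p ord0 i -> ((c * expR (a * p ord0 i))%:E <= mgf p)%E.
Proof.
pose m s := fine (\int[lebesgue R n]_(y in orthant s) (J y)%:E)%E.
have mJE : measurable_fun [set: lebesgueRn R n] (EFin \o J) by apply/measurable_EFinP.
have mo s := borel_lebesgue_measurable (measurable_orthant s).
have mE s : (m s)%:E = (\int[lebesgue R n]_(y in orthant s) (J y)%:E)%E.
  rewrite fineK// ge0_fin_numE ?integral_ge0//; last by move=> y _; rewrite lee_fin.
  apply: le_lt_trans (ltry 1); rewrite -J1; apply: ge0_subset_integral => //.
  by move=> y _; rewrite lee_fin.
exists (\big[Order.min/1]_s m s).
  apply: lt_bigmin => // s _; rewrite -lte_fin mE.
  exact: integral_orthant_gt0.
move=> p pi0; pose s := [ffun j => p ord0 j < 0].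
have cs : \big[Order.min/1]_s m s <= m s by exact: bigmin_le_cond.
apply: (@le_trans _ _ ((m s)%:E * (expR (a * p ord0 i))%:E)%E).
  by rewrite -EFinM lee_fin ler_wpM2r// expR_ge0.
have mJo : measurable_fun (orthant s : set (lebesgueRn R n)) (EFin \o J).
  exact: measurable_funTS mJE.
rewrite mE muleC -(ge0_integralZl _ (mo s) mJo); last 2 first.
- by move=> y _; rewrite lee_fin.
- by rewrite lee_fin expR_ge0.
apply: (@le_trans _ _
  (\int[lebesgue R n]_(y in orthant s) (expR (dot p y) * J y)%:E)%E).
  apply: ge0_le_integral.
  - exact: mo.
  - by move=> y _; rewrite mule_ge0// lee_fin ?expR_ge0.
  - exact: (emeasurable_funM _ mJo).
  - exact: measurable_funTS (measurable_mgf_integrand p).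
  move=> y [ay sy]; rewrite -EFinM lee_fin ler_wpM2r// ler_expR /dot (bigD1 i)//=.
  rewrite mulrC ler_wpDr// ?ler_wpM2l//; apply: sumr_ge0 => j ji.
  have := sy j ji; rewrite ffunE => sy_ge0.
  by rewrite [X in X * _](realEsign (num_real _)) -mulrA mulrCA mulr_ge0.
apply: (ge0_subset_integral _ (mo s) measurableT (measurable_mgf_integrand p)) => //.
by move=> y _; rewrite lee_fin mulr_ge0// expR_ge0.
Qed.

End lower_bound.

End moment_generating_function.

(** * Bounds on the Legendre transform *)

Section legendre_bounds.
Context (R : realType) (n : nat) (J : 'rV[R]_n -> R) (eta : R) (Lstar : R -> R).
Hypothesis eta0 : 0 < eta.
Hypothesis J0 : forall y, 0 <= J y.
Hypothesis mJ : measurable_fun [set: lebesgueRn R n] J.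
Hypothesis J1 : (\int[lebesgue R n]_y (J y)%:E = 1)%E.
Hypothesis supp_J : ess_support J = [set x | enorm x <= eta].
Hypothesis LstarE :
  forall q, (Lstar (enorm q))%:E = legendre (hamiltonian J) q.
Variable i : 'I_n.

(** The test point is the maximiser of r t - e^(eta t), up to an additive
constant. *)
Lemma radial_legendre_ge r : 1 <= r -> r * ln r / eta - r <= Lstar r.
Proof.
move=> r1; have r0 : 0 < r by exact: lt_le_trans r1.
rewrite -[X in Lstar X](enorm_scale_delta i (ltW r0)) -lee_fin LstarE.
pose p : 'rV[R]_n := (ln r / eta) *: delta_mx ord0 i.
have pE : \sum_j `|p ord0 j| = ln r / eta.
  rewrite (bigD1 i)//= big1 => [|j ji].
    by rewrite !mxE !eqxx mulr1 addr0 ger0_norm// divr_ge0 ?ln_ge0// ltW.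
  by rewrite !mxE (negbTE ji) andbF mulr0 normr0.
have Hp : (hamiltonian J p <= (r - 1)%:E)%E.
  rewrite (hamiltonian_mgf J0 mJ J1 supp_J) EFinB leeD2r//.
  apply: le_trans (mgf_le J0 mJ J1 supp_J p) _.
  by rewrite pE mulrCA divff ?gt_eqF// mulr1 lnK.
apply: le_trans (ereal_sup_ubound _); last by exists p.
rewrite dot_scale_delta !mxE !eqxx mulr1.
apply: le_trans (leeB (lexx _) Hp).
by rewrite -EFinB lee_fin mulrA lerB// gerBl.
Qed.

(** For p_i >= 0 the competitor is at most r p_i - c e^(a p_i) + 1, a
one-dimensional problem with maximum (r / a) (ln (r / (a c)) - 1) + 1; for
p_i < 0 the bound H >= -1 suffices, provided that ln r >= ln (a c). *)
Lemma radial_legendre_le (a : R) : 0 < a -> a < eta ->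
  exists C : R, forall r, 1 <= r -> - C <= ln r -> Lstar r <= r / a * (ln r + C) + 1.
Proof.
move=> a0 aeta.
have [c c0 mgfc] := mgf_ge J0 mJ J1 supp_J i a0 aeta.
exists (- ln (a * c)) => r r1; rewrite opprK => lnr.
have r0 : 0 < r by exact: lt_le_trans r1.
rewrite -[X in Lstar X](enorm_scale_delta i (ltW r0)) -lee_fin LstarE.
apply: ge_ereal_sup => _ [p _ <-].
rewrite (hamiltonian_mgf J0 mJ J1 supp_J) dot_scale_delta.
have [pi0|pi0] := leP 0 (p ord0 i); last first.
  have : ((-1)%:E <= mgf J p - 1)%E by rewrite -[leLHS]add0e leeD2r// mgf_ge0.
  move=> /(leeB (lexx (r * p ord0 i)%:E)) /le_trans; apply.
  rewrite -EFinB lee_fin opprK lerD2r (@le_trans _ _ 0)//.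
    by rewrite nmulr_lle0// ltW.
  by rewrite mulr_ge0 ?divr_ge0 ?subr_ge0// ltW.
set t := p ord0 i; have h : ((c * expR (a * t) - 1)%:E <= mgf J p - 1)%E.
  by rewrite EFinB leeD2r// mgfc.
apply: le_trans (leeB (lexx _) h) _.
rewrite -EFinB lee_fin.
(* The tangent line inequality for exp, at the point where
   r t - c exp (a t) is maximal, namely exp (a t) = r / (a c). *)
have := expR_ge1Dx (a * t - ln (r / (a * c))).
rewrite expRD expRN lnK ?posrE ?divr_gt0 ?mulr_gt0// ln_div ?posrE ?mulr_gt0//.
rewrite invf_div => le_exp.
have : r / a * (1 + (a * t - (ln r - ln (a * c)))) <= c * expR (a * t).
  apply: le_trans (ler_wpM2l _ le_exp) _; first by rewrite divr_ge0// ltW.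
  by rewrite le_eqVlt; apply/orP; left; apply/eqP; field; rewrite !gt_eqF.
have -> : r / a * (1 + (a * t - (ln r - ln (a * c)))) =
    r / a + r * t - r / a * (ln r - ln (a * c)) by field; rewrite gt_eqF.
have : 0 <= r / a by rewrite divr_ge0// ltW.
lra.
Qed.

End legendre_bounds.

(** * The asymptotic equivalence *)

(** The upper bound is used with a = eta / (1 + e / 2), which leaves half of the
tolerance e to absorb the terms of order 1 / ln r. *)
Lemma cvg_div_xlnx (R : realType) (eta : R) (f : R -> R) : 0 < eta ->
  (forall r, 1 <= r -> r * ln r / eta - r <= f r) ->
  (forall a, 0 < a -> a < eta -> exists C : R,
    forall r, 1 <= r -> - C <= ln r -> f r <= r / a * (ln r + C) + 1) ->
  f r / (r * ln r / eta) @[r --> +oo] --> (1 : R).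
Proof.
move=> eta0 f_ge f_le; apply/cvgrPdist_le => e e0.
pose k := 1 + e / 2; have k0 : 0 < k by rewrite addr_gt0// divr_gt0.
have [||C fC] := f_le (eta / k).
- by rewrite divr_gt0.
- by rewrite ltr_pdivrMr// ltr_pMr// ltrDl divr_gt0.
(* One summand for each condition put on ln r below. *)
pose K := `|C| + eta / e + 2 * (k * `|C| + eta) / e + 1.
have nC : 0 <= `|C| by [].
have eta_e : 0 < eta / e by rewrite divr_gt0.
have kC : 0 <= k * `|C| by rewrite mulr_ge0// ltW.
have kCe : 0 < 2 * (k * `|C| + eta) / e by rewrite divr_gt0// mulr_gt0// ltr_wpDl.
have K1 : 1 <= K by rewrite /K; lra.
near=> r.
have rK : expR K <= r by near: r; exact: nbhs_pinfty_ge.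
have r1 : 1 <= r by apply: le_trans rK; rewrite -expR0 ler_expR; lra.
have r0 : 0 < r by exact: lt_le_trans r1.
have lnrK : K <= ln r by rewrite -ler_expR lnK.
have l0 : 0 < ln r by apply: lt_le_trans lnrK; exact: lt_le_trans K1.
have := f_ge r r1; have : - C <= ln r.
  by have := ler_norm (- C); rewrite normrN; move: lnrK; rewrite /K; lra.
move=> /(fC r r1); set l := ln r; rewrite -/l in lnrK l0; move: (f r) => x xle xge.
have rl0 : 0 < r * l / eta by rewrite divr_gt0// mulr_gt0.
rewrite ler_distlC; apply/andP; split.
  rewrite ler_pdivlMr//; apply: le_trans xge.
  have : eta <= e * l.
    by rewrite mulrC -ler_pdivrMr//; apply: le_trans lnrK; rewrite /K; lra.
  move=> h; have : r <= e * (r * l / eta).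
    have -> : e * (r * l / eta) = r * ((e * l) / eta) by ring.
    by rewrite ler_peMr ?(ltW r0)// ler_pdivlMr// mul1r.
  lra.
rewrite ler_pdivrMr//; apply: le_trans xle _.
have h : 2 * (k * `|C| + eta) <= e * l.
  by rewrite [e * l]mulrC -ler_pdivrMr//; apply: le_trans lnrK; rewrite /K; lra.
have h2 : k * (l + C) + eta <= (1 + e) * l.
  have : k * C <= k * `|C| by rewrite ler_pM2l// ler_norm.
  rewrite /k in h *; lra.
have -> : (1 + e) * (r * l / eta) = r / eta * ((1 + e) * l) by ring.
apply: (@le_trans _ _ (r / eta * (k * (l + C) + eta))); last first.
  by rewrite ler_wpM2l// divr_ge0// ltW.
have -> : r / eta * (k * (l + C) + eta) = r / (eta / k) * (l + C) + r.
  by field; rewrite !gt_eqF.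
by rewrite lerD2l.
Unshelve. all: by end_near. Qed.

Theorem lemma4p1 (R : realType) (N : nat) (eta : R)
    (J : 'rV[R]_N -> R) (Lstar : R -> R) :
  (1 <= N)%N ->
  0 < eta ->
  (forall y, 0 <= J y) ->
  measurable_fun [set: lebesgueRn R N] J ->
  radially_symmetric J ->
  (\int[lebesgue R N]_y (J y)%:E = 1)%E ->
  (forall p, (hamiltonian J p < +oo)%E) ->
  ess_support J = [set x | enorm x <= eta] ->
  (forall q, (Lstar (enorm q))%:E = legendre (hamiltonian J) q) ->
  Lstar r / (r * ln r / eta) @[r --> +oo] --> (1 : R).
Proof.
move=> N1 eta0 J0 mJ _ J1 _ supp_J LstarE; pose i := Ordinal N1.
apply: cvg_div_xlnx => //.
  exact: (radial_legendre_ge eta0 J0 mJ J1 supp_J LstarE i).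
exact: (radial_legendre_le J0 mJ J1 supp_J LstarE i).
Qed.
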